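(* For any positive integer $k$ there exist a finite abelian group $G$ and a generating set $B\subseteq G$ such that the Cayley graph $\mathrm{Cay}(G,B)$ has undirected diameter at most $2$ and directed diameter at least $k$.
   Context: For a finite group $G$ (written additively when abelian) and a generating set $B\subseteq G$, the Cayley graph $\mathrm{Cay}(G,B)$ is the directed graph with vertex set $G$ in which there is a directed edge from $x$ to $y$ if and only if $y=x+g$ for some $g\in B$. The directed diameter of a directed graph is the maximum over ordered pairs of vertices of the length of a shortest path respecting edge orientations (it is finite for such Cayley graphs). The undirected diameter is the maximum distance between two vertices when edge orientations are ignored. *)

(* Defs.v *)
From mathcomp Require Import all_boot all_fingroup.
Set Implicit Arguments.
Unset Strict Implicit.
Unset Printing Implicit Defensive.

Section Distance.

Variables (T : finType) (e : rel T).

Definition has_walk (x y : T) (n : nat) : bool :=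
  [exists p : n.-tuple T, path e x p && (last x p == y)].

(* A shortest path visits each vertex at most once, so it has fewer than #|T|
   edges; the value is #|T| exactly when y is not reachable from x
   (see distanceP, distance_le and distance_disconnected). *)
Definition distance (x y : T) : nat := find (has_walk x y) (iota 0 #|T|).

Definition diameter : nat := \max_(x : T) \max_(y : T) distance x y.

Definition underlying : rel T := [rel x y | e x y || e y x].

Lemma distance_le x p : path e x p -> distance x (last x p) <= size p.
Proof.
move=> ep; have [le_Tp | lt_pT] := leqP #|T| (size p).
  by apply: leq_trans le_Tp; rewrite -[leqRHS](size_iota 0) find_size.
rewrite leqNgt; apply/negP => /(before_find 0)/negbT/negP; case.
rewrite nth_iota // add0n; apply/existsP; exists (in_tuple p).
by rewrite ep eqxx.
Qed.

Lemma distanceP x y : connect e x y ->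
  exists p, [/\ path e x p, last x p = y & size p = distance x y].
Proof.
case/connectP=> p0 /shortenP[p ep Up _] ->.
have lt_pT : size p < #|T|.
  by rewrite -[_.+1]/(size (x :: p)) -(card_uniqP Up) max_card.
have lt_d := leq_ltn_trans (distance_le ep) lt_pT.
have: has (has_walk x (last x p)) (iota 0 #|T|) by rewrite has_find size_iota.
move/(nth_find 0); rewrite nth_iota // add0n.
by case/existsP=> q /andP[eq /eqP lq]; exists q; rewrite size_tuple.
Qed.

Lemma distance_disconnected x y : ~~ connect e x y -> distance x y = #|T|.
Proof.
move=> nexy; rewrite /distance hasNfind ?size_iota //.
apply/hasPn=> n _; apply: contra nexy => /existsP[p /andP[ep /eqP <-]].
by apply/connectP; exists p.
Qed.

End Distance.

Section Cayley.

Variables (gT : finGroupType) (B : {set gT}).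
Local Open Scope group_scope.

Definition cayley : rel gT := [rel x y | [exists g in B, y == x * g]].

Lemma cayley_connect : <<B>> = [set: gT] -> forall x y, connect cayley x y.
Proof.
move=> genB x y; have: x^-1 * y \in <<B>> by rewrite genB inE.
case/gen_prodgP=> n [c Bc] /(canRL (mulKVg x)) ->.
elim: n c Bc => [|n IHn] c Bc; first by rewrite big_ord0 mulg1.
rewrite big_ord_recr /= mulgA.
apply: connect_trans (IHn _ (fun i => Bc _)) (connect1 _).
by apply/exists_inP; exists (c ord_max); rewrite ?Bc.
Qed.

End Cayley.

(* Main.v *)
(** Given f : H -> H, let B consist of all f x and f x + x. Every x is a
    difference of two elements of B, so the undirected diameter is at most 2,
    and it remains to choose H, f and a target t that is not a sum of at most k
    terms f x_i + e_i x_i with e_i in {0, 1}. This is done by induction on the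
    number r of distinct values among the x_i. For the step, adjoin to H one
    coordinate over F_p, with p > k, for each map c : H -> F_p, put f = - c x * z
    on the coordinate z of index c, and add 1 to the target there. If two of the
    r + 1 values merge in H, the old target is already missed; otherwise taking
    for c the average of the e_i over each value makes the coordinate of the sum
    0 instead of 1. *)

Require Import Defs.
From mathcomp Require Import all_boot all_fingroup.
From HB Require Import structures.
From mathcomp Require Import all_algebra.
Import GRing.Theory FinRing.Theory.

(** Makes products, and below finite function spaces, available as [finZmodType]. *)
HB.instance Definition _ (U V : finZmodType) := GRing.Zmodule.on (U * V)%type.
HB.instance Definition _ (I : finType) (V : finZmodType) :=
  GRing.Zmodule.on {ffun I -> V}.

Section AvoidedSums.
Set Implicit Arguments.
Unset Strict Implicit.
Unset Printing Implicit Defensive.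
Local Open Scope ring_scope.

Definition shifted_sum (H : zmodType) (f : H -> H) n
    (x : 'I_n -> H) (e : 'I_n -> bool) : H :=
  \sum_i (f (x i) + x i *+ e i).

Definition avoids (H : finZmodType) (f : H -> H) (t : H) (k r : nat) :=
  forall n (x : 'I_n -> H) (e : 'I_n -> bool),
    (n <= k)%N -> (#|[set x i | i : 'I_n]| <= r)%N -> shifted_sum f x e <> t.

Lemma natr_Fp_neq0 p v : prime p -> (0 < v < p)%N -> v%:R != 0 :> 'F_p.
Proof.
move=> p_pr /andP[v_gt0 lt_vp].
by rewrite -(dvdn_pcharf (pchar_Fp p_pr)) gtnNdvd.
Qed.

(** Take [c y] to be the average of [e] over the fibre of [h] at [y]: a nonempty fibre has at most
    [n < p] elements, so its size is invertible in ['F_p]. Over an empty fibre the sum is empty. *)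
Lemma avoiding_slope (H : finType) p n (h : 'I_n -> H) (e : 'I_n -> bool) :
    prime p -> (n < p)%N ->
  exists c : {ffun H -> 'F_p},
    forall y, \sum_(i | h i == y) ((e i)%:R - c y) = 0.
Proof.
move=> p_pr lt_np; pose v y := #|[pred i | h i == y]|.
exists [ffun y => (\sum_(i | h i == y) (e i)%:R) / (v y)%:R] => y.
rewrite sumrB ffunE sumr_const -/(v y) -[X in _ - X]mulr_natr.
have [v0 | v_gt0] := posnP (v y); last first.
  rewrite divfK ?subrr // natr_Fp_neq0 // v_gt0 /=.
  by rewrite (leq_ltn_trans _ lt_np) // -[leqRHS]card_ord max_card.
rewrite v0 mulr0 subr0 big_pred0 // => i.
by apply/negbTE/negP=> hi; move/card0_eq/(_ i): v0; rewrite inE hi.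
Qed.

Lemma avoids_succ (H : finZmodType) (f : H -> H) (t : H) (k r : nat) :
    avoids f t k r ->
  exists (H' : finZmodType) (f' : H' -> H') (t' : H'), avoids f' t' k r.+1.
Proof.
move=> avf; have [p lt_kp p_pr] := prime_above k.
pose Z := {ffun {ffun H -> 'F_p} -> 'F_p}.
pose f' (y : H * Z) : H * Z :=
    (f y.1, [ffun c : {ffun H -> 'F_p} => - c y.1 * y.2 c]).
exists (H * Z)%type, f', (t, [ffun => 1]) => n x e le_nk le_xr eq_t.
have eq1: shifted_sum f (fst \o x) e = t.
  rewrite -[t]/(fst (t, [ffun => 1] : Z)) -eq_t /shifted_sum raddf_sum.
  by apply: eq_bigr => i _; rewrite raddfD raddfMn.
(* Were two values merged by [fst], the projections would take at most [r] values, and [avf] would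
   contradict [eq1]. *)
have fst_inj : {in [set x i | i : 'I_n] &, injective fst}.
  apply/imset_injP; rewrite eqn_leq leq_imset_card /=.
  apply: leq_trans le_xr _; rewrite ltnNge; apply/negP=> le_r.
  apply: (avf _ _ _ le_nk _ eq1); apply: leq_trans le_r.
  by rewrite -imset_comp.
have [c sum_c0] := avoiding_slope (fst \o x) e p_pr (leq_ltn_trans le_nk lt_kp).
have: (shifted_sum f' x e).2 c = 0.
  rewrite /shifted_sum raddf_sum sum_ffunE.
  under eq_bigr => i _ do
    rewrite raddfD raddfMn /= !ffunE ffunMnE -mulr_natl -mulrDl addrC.
  (* Term [i] is now [((e i)%:R - c (x i).1) * (x i).2 c]. By [fst_inj], [x] is constant on each
     fibre of [fst \o x], so the second factor comes out and [sum_c0] applies. *)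
  rewrite (partition_big (fst \o x) xpredT) //= big1 // => y _.
  have [i0 /eqP xi0 | no_i] := pickP [pred i | (x i).1 == y]; last first.
    exact: big_pred0.
  rewrite -[RHS](mul0r ((x i0).2 c)) -[in RHS](sum_c0 y) mulr_suml.
  apply: eq_bigr => i /eqP xi; have -> : x i = x i0; last by rewrite xi0.
  by apply: fst_inj; rewrite ?imset_f // xi.
by rewrite eq_t ffunE; apply/eqP; rewrite oner_eq0.
Qed.

Lemma avoids_exists k r :
  exists (H : finZmodType) (f : H -> H) (t : H), avoids f t k r.
Proof.
elim: r => [|r [H [f [t /avoids_succ//]]]].
(* With no value allowed, the only sum is the empty one, so any nonzero target is avoided. *)
exists 'F_2, id, 1 => n x e _.
rewrite leqn0 cards_eq0 => /eqP im0; rewrite /shifted_sum big1 => [/eqP|i _].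
  by rewrite eq_sym oner_eq0.
by have: x i \in [set x j | j : 'I_n]; [exact: imset_f | rewrite im0 inE].
Qed.

End AvoidedSums.

Section ShiftGraph.
Set Implicit Arguments.
Unset Strict Implicit.
Unset Printing Implicit Defensive.
Local Open Scope ring_scope.

Variables (H : finZmodType) (f : H -> H).

Definition shift_set : {set H} := [set f y.1 + y.1 *+ y.2 | y : H * bool].

Lemma mem_shift_set y (b : bool) : f y + y *+ b \in shift_set.
Proof. by apply/imsetP; exists (y, b). Qed.

Lemma gen_shift_set : <<shift_set>>%g = [set: H].
Proof.
apply/eqP; rewrite eqEsubset subsetT /=; apply/subsetP=> y _.
have -> : y = ((f y + y *+ false)^-1 * (f y + y *+ true))%g.
  by rewrite zmodMgE zmodVgE mulr0n addr0 mulr1n addKr.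
by rewrite groupM ?groupV ?mem_gen ?mem_shift_set.
Qed.

Lemma undirected_diameter_le2 :
  (diameter (underlying (cayley shift_set)) <= 2)%N.
Proof.
apply/bigmax_leqP=> x _; apply/bigmax_leqP=> y _.
have edge z u (b : bool) : cayley shift_set z (z + (f u + u *+ b)).
  by apply/exists_inP; exists (f u + u *+ b); rewrite ?mem_shift_set.
pose u := y - x.
(* Go forward along [f u + u], then backward along [f u]; the two edges meet because [x + u = y]. *)
apply: (@distance_le _ _ x [:: x + (f u + u); y]).
apply/and3P; split=> //; apply/orP; [left; exact: edge x u true | right].
suff -> : x + (f u + u) = y + (f u + u *+ false) by apply: edge.
by rewrite mulr0n addr0 addrCA [x + u]addrC subrK addrC.
Qed.

Lemma path_shifted_sum x q : path (cayley shift_set) x q ->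
  exists (y : 'I_(size q) -> H) (e : 'I_(size q) -> bool),
    last x q = x + shifted_sum f y e.
Proof.
move=> xq; have [s sz_s ->] : exists2 s : seq (H * bool), size s = size q &
    last x q = x + \sum_(z <- s) (f z.1 + z.1 *+ z.2).
  elim: q x xq => [|x' q IHq] x /=; first by exists [::]; rewrite ?big_nil ?addr0.
  case/andP=> /exists_inP[_ /imsetP[z _ ->] /eqP->] /IHq[s <- ->].
  by exists (z :: s); rewrite // big_cons addrA.
rewrite -sz_s; exists (fst \o tnth (in_tuple s)), (snd \o tnth (in_tuple s)).
by rewrite big_tnth.
Qed.

(** A walk of length [n] from [0] to [t] writes [t] as a shifted sum of [n] terms. These take at
    most [n] values, so [r = k] covers every walk of length at most [k]. *)
Lemma directed_diameter_ge t k :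
  avoids f t k k -> (k <= diameter (cayley shift_set))%N.
Proof.
move=> avf; apply: leq_trans (leq_trans (leq_bigmax t) (leq_bigmax (0 : H))).
have [q [xq last_q sz_q]] := distanceP (cayley_connect gen_shift_set 0 t).
rewrite -sz_q leqNgt; apply/negP=> /ltnW le_qk.
have [y [e]] := path_shifted_sum xq.
rewrite last_q add0r => /esym; apply: avf => //.
by apply: leq_trans (leq_imset_card _ _) _; rewrite card_ord.
Qed.

End ShiftGraph.

Theorem corollary5p2 (k : nat) (k_gt0 : 0 < k) :
  exists (gT : finGroupType) (B : {set gT}),
    [/\ abelian [set: gT],
        <<B>>%g = [set: gT],
        diameter (underlying (cayley B)) <= 2
      & k <= diameter (cayley B)].
Proof.
have [H [f [t avf]]] := avoids_exists k k.
exists H, (shift_set f); split.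
- exact: zmod_abelian.
- exact: gen_shift_set.
- exact: undirected_diameter_le2.
- exact: directed_diameter_ge avf.
Qed.
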